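(* Let $\Omega \subset \mathbb{R}^2$ be a compact convex set with nonempty interior, let $M > 0$, and let $f : \mathbb{R}^2 \to \mathbb{R}$ be a positive continuous function satisfying the following condition: for every $N > 0$ there exists $\delta > 0$ such that for all $x, y \in \mathbb{R}^2$ with $y \neq 0$ and $(1+|x|)/|y| < \delta$ one has $$\frac{(1+|x|)\,f(x)}{|y|\,f(y)} > N .$$ Suppose that all points of $\partial\Omega$ are regular. Let $u$ be a solution to the problem of minimizing $$F(u) = \int_\Omega f(\nabla u(x))\, dx$$ in the class of concave functions $u : \Omega \to \mathbb{R}$ satisfying $0 \le u(x) \le M$ for all $x \in \Omega$. Then $u(x) = 0$ for all $x \in \partial\Omega$.
   Context: $|\cdot|$ denotes the Euclidean norm on $\mathbb{R}^2$. A concave function $u$ on $\Omega$ is differentiable at almost every point of $\Omega$, so $\nabla u$ exists almost everywhere and the integral $F(u)$ is well defined. A solution to the minimization problem is a function $u$ in the stated class such that $F(u) \le F(v)$ for every $v$ in the class. No continuity of $u$ up to the boundary is assumed. A support line to $\Omega$ at $x_0 \in \partial\Omega$ is a line through $x_0$ such that $\Omega$ is contained in one of the two closed half-planes bounded by this line. A point $x_0 \in \partial\Omega$ is called regular if the support line to $\Omega$ at $x_0$ is unique. *)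

(* Defs.v *)
From HB Require Import structures.
From mathcomp Require Import all_boot all_order all_algebra.
From mathcomp Require Import all_classical all_reals all_analysis.

Set Implicit Arguments.
Unset Strict Implicit.
Unset Printing Implicit Defensive.

Import Order.TTheory GRing.Theory Num.Theory.
Import numFieldNormedType.Exports.

Local Open Scope classical_set_scope.
Local Open Scope ring_scope.

Section Plane.
Context {R : realType}.
Implicit Types (x a : R * R) (A L : set (R * R)).

(* The plane is R * R.  The library norm there is the max norm, hence the
   explicit Euclidean norm; the product topology is the Euclidean one. *)
Definition enorm x : R := Num.sqrt (x.1 ^+ 2 + x.2 ^+ 2).

Definition dotp a x : R := a.1 * x.1 + a.2 * x.2.

Definition boundary A : set (R * R) := closure A `\` A°.

Definition line a (c : R) : set (R * R) := [set x | dotp a x = c].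

Definition support_line A x L : Prop :=
  exists (a : R * R) (c : R),
    [/\ a != 0, L = line a c, L x &
        A `<=` [set y | dotp a y <= c] \/ A `<=` [set y | c <= dotp a y]].

Definition regular_point A x : Prop :=
  boundary A x /\ exists! L, support_line A x L.

Definition concave_function A (u : R * R -> R) : Prop :=
  convex_function A (\- u).

(* The differential ['d u x] is a junk linear map where u is not
   differentiable. *)
Definition grad (u : R * R -> R) x : R * R :=
  ('d u x (1, 0), 'd u x (0, 1)).

Definition lebesgue2 := (@lebesgue_measure R \x @lebesgue_measure R)%E.

End Plane.

Section Functional.
Context {R : realType}.
Implicit Types (Omega : set (R * R)) (M : R) (f u : R * R -> R).

(* A function on Omega is represented by a total function.  For u concave on a
   convex Omega, the points of Omega where u is not differentiable and the
   boundary of Omega are Lebesgue-null, so neither the values of u off Omega nor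
   the junk gradients affect this integral. *)
Definition energy Omega f u : \bar R :=
  (\int[lebesgue2]_(x in Omega) (f (grad u x))%:E)%E.

Definition admissible Omega M u : Prop :=
  concave_function Omega u /\ forall x, Omega x -> 0 <= u x <= M.

Definition minimizer Omega M f u : Prop :=
  admissible Omega M u /\
  forall v, admissible Omega M v -> (energy Omega f u <= energy Omega f v)%E.

Definition growth_condition f : Prop :=
  forall N : R, 0 < N -> exists2 delta : R, 0 < delta &
    forall x y : R * R, y != 0 -> (1 + enorm x) / enorm y < delta ->
      N < ((1 + enorm x) * f x) / (enorm y * f y).

End Functional.

(* Main.v *)
Require Import Defs.
From HB Require Import structures.
From mathcomp Require Import all_boot all_order all_algebra.
From mathcomp Require Import all_classical all_reals all_analysis.
From mathcomp Require Import measurable_realfun simple_functions.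
From mathcomp Require Import ring lra.
Import Order.TTheory GRing.Theory Num.Theory.
Import numFieldNormedType.Exports.
Import HBNNSimple.
Local Open Scope classical_set_scope.
Local Open Scope ring_scope.

(* Suppose u > 0 at a boundary point x0 and let d >= 0 be the linear distance to
   a support line at x0.  Cut u by the steep plane K d, K = M / T: the minimum v
   of the two is admissible and differs from u only inside the slab
   S = {x in Omega | d x < T}, where its gradient has norm of order K.  Let h be
   the limit, as T tends to 0, of the supremum of u over S; then h > 0, and S
   contains a point x1 where u is almost h.  By concavity u almost equals h on
   every copy (1 - e) x1 + e ((1 - t) S + t p) of S, p being a fixed interior
   point, and even on a ball of radius of order e t around each point of such a
   copy, so that |grad u| is at most delta K there once t is of order T / delta.
   About 1 / delta of these copies, for consecutive values of t, are disjoint and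
   lie in {v < u}; since e is of order delta, their total area is at least of
   order delta |S|.  On them the growth condition gives
   f (grad u) > (N / delta) f (grad v), hence their energy exceeds that of v on
   all of S by a factor of order N, a contradiction for N large.

   Almost everywhere differentiability of u is not needed: where u is not
   differentiable the junk value of grad u is 0, which also satisfies the
   gradient bound.  Since f (grad u) is thus not known to be measurable, its
   integral is handled as a supremum over simple functions. *)

Set Implicit Arguments.
Unset Strict Implicit.
Unset Printing Implicit Defensive.

Local Notation plane R := (measurableTypeR R * measurableTypeR R)%type.

(** * Integrals of possibly non-measurable nonnegative functions *)

Section LowerIntegral.
Context d (T : measurableType d) (R : realType) (mu : {measure set T -> \bar R}).
Implicit Types (A B D N : set T) (g : T -> R) (h : {nnsfun T >-> R}).

(** The integral of a nonnegative function is a supremum over the simple functions below it, so it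
    is enough to bound their integrals. *)
Lemma ge0_integral_le_ub D g (I : \bar R) : (forall x, 0 <= g x) ->
  (forall h, (forall x, h x <= (g \_ D) x) ->
    (\int[mu]_x (h x)%:E <= I)%E) ->
  (\int[mu]_(x in D) (g x)%:E <= I)%E.
Proof.
move=> g0 hI; rewrite ge0_integralE; last by move=> x _; rewrite lee_fin.
apply: ge_ereal_sup => _ [h /= hg <-].
have := @integral_nnsfun _ _ _ mu setT measurableT h.
rewrite patch_setT => <-; apply: hI => x.
have := hg x; rewrite /patch; case: ifPn => _; by rewrite lee_fin.
Qed.

Lemma nnsfun_integral_le D g h : (forall x, 0 <= g x) ->
  (forall x, h x <= (g \_ D) x) ->
  (\int[mu]_x (h x)%:E <= \int[mu]_(x in D) (g x)%:E)%E.
Proof.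
move=> g0 hg; rewrite [leRHS]ge0_integralE; last by move=> x _; rewrite lee_fin.
have := @integral_nnsfun _ _ _ mu setT measurableT h.
rewrite patch_setT => ->; apply: ereal_sup_ubound; exists h => //= x.
have := hg x; rewrite /patch; case: ifPn => _; by rewrite lee_fin.
Qed.

Lemma measurable_EFin_nnsfun D h : measurable_fun D (fun x => (h x : R)%:E).
Proof. by apply/measurable_EFinP; exact: measurable_funTS. Qed.

Lemma measurable_EFin_cst_indic D A (c : R) : measurable A ->
  measurable_fun D (fun x => (c * \1_A x : R)%:E).
Proof.
by move=> mA; apply/measurable_EFinP; exact: measurable_funM.
Qed.

Lemma integral_cst_indic A (c : R) : measurable A -> 0 <= c ->
  (\int[mu]_x (c * \1_A x)%:E = c%:E * mu A)%E.
Proof.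
move=> mA c0; under eq_integral do rewrite EFinM.
rewrite ge0_integralZl_EFin//.
  by rewrite integral_indic// setIT.
by apply/measurable_EFinP; exact: measurable_indic.
Qed.

(** A simple function [h] below [g] on [D] is at most the sum of its restrictions to [B] and [N] and
    of [C] times the indicator of [A]; additivity is applied to these measurable functions only. *)
Lemma ge0_integral_le_split D A B N g (C : R) :
  measurable A -> measurable B -> measurable N -> mu N = 0 ->
  D `<=` B `|` A `|` N -> (forall x, 0 <= g x) ->
  0 <= C -> (forall x, A x -> g x <= C) ->
  (\int[mu]_(x in D) (g x)%:E <= \int[mu]_(x in B) (g x)%:E + C%:E * mu A)%E.
Proof.
move=> mA mB mN N0 DABN g0 C0 gC; apply: ge0_integral_le_ub => // h hg.
pose hB := mul_nnsfun h (indic_nnsfun R mB).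
pose hN := mul_nnsfun h (indic_nnsfun R mN).
have h0 x : 0 <= h x by exact: fun_ge0.
have hle x : h x <= hB x + C * \1_A x + hN x.
  have -> : hB x = h x * \1_B x by [].
  have -> : hN x = h x * \1_N x by [].
  have := hg x; rewrite /patch; case: ifPn => [/set_mem Dx hgx|_ hx0]; last first.
    have -> : h x = 0 by apply/eqP; rewrite eq_le hx0 h0.
    by rewrite !mul0r add0r addr0 mulr_ge0.
  case: (DABN _ Dx) => [[Bx|Ax]|Nx].
  - rewrite [\1_B x]indicE mem_set// mulr1 -addrA lerDl addr_ge0 ?mulr_ge0//.
  - rewrite [\1_A x]indicE mem_set// mulr1 (le_trans hgx)// (le_trans (gC _ Ax))//.
    by rewrite addrAC lerDr addr_ge0 ?mulr_ge0.
  - by rewrite [\1_N x]indicE mem_set// mulr1 lerDr addr_ge0 ?mulr_ge0.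
have hN0 : (\int[mu]_x (hN x)%:E = 0)%E.
  under eq_integral do rewrite /= EFinM.
  have -> : (\int[mu]_x ((h x)%:E * (\1_N x)%:E))%E = (\int[mu]_(x in N) (h x)%:E)%E.
    rewrite [RHS]integral_mkcond; apply: eq_integral => x _.
    by rewrite /patch indicE; case: ifPn; rewrite ?mule1 ?mule0.
  by rewrite null_set_integral//; exact: measurable_EFin_nnsfun.
apply: (@le_trans _ _ (\int[mu]_x ((hB x)%:E + (C * \1_A x)%:E + (hN x)%:E))%E).
  apply: ge0_le_integral => //.
  - by move=> x _; rewrite lee_fin.
  - exact: measurable_EFin_nnsfun.
  - apply: emeasurable_funD; last exact: measurable_EFin_nnsfun.
    apply: emeasurable_funD; [exact: measurable_EFin_nnsfun|].
    exact: measurable_EFin_cst_indic.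
  - by move=> x _; rewrite -!EFinD lee_fin.
rewrite (@ge0_integralD _ _ _ mu _ measurableT
  (fun x => ((hB x)%:E + (C * \1_A x)%:E)%E) (fun x => (hN x)%:E)); first last.
- exact: measurable_EFin_nnsfun.
- by move=> x _; rewrite lee_fin.
- apply: emeasurable_funD; [exact: measurable_EFin_nnsfun|].
  exact: measurable_EFin_cst_indic.
- by move=> x _; rewrite -EFinD lee_fin addr_ge0 ?mulr_ge0.
rewrite [X in (_ + X <= _)%E]hN0 adde0.
rewrite (@ge0_integralD _ _ _ mu _ measurableT
  (fun x => (hB x)%:E) (fun x => (C * \1_A x)%:E)); first last.
- exact: measurable_EFin_cst_indic.
- by move=> x _; rewrite lee_fin mulr_ge0.
- exact: measurable_EFin_nnsfun.
- by move=> x _; rewrite lee_fin.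
rewrite integral_cst_indic// leeD2r//; apply: (@nnsfun_integral_le _ _ hB) => // x.
have -> : hB x = h x * \1_B x by [].
rewrite /patch indicE; case: ifPn => xB; last by rewrite mulr0.
by rewrite mulr1 (le_trans (hg x))// /patch; case: ifPn.
Qed.

(** As [A] and [B] are disjoint, adding [c] times the indicator of [A] to a simple function below
    [g] on [B] gives one below [g] on [D]. *)
Lemma ge0_integral_ge_split D A B g (c : R) :
  measurable A -> (mu A < +oo)%E -> [disjoint A & B] ->
  A `<=` D -> B `<=` D -> (forall x, 0 <= g x) ->
  0 <= c -> (forall x, A x -> c <= g x) ->
  (\int[mu]_(x in B) (g x)%:E + c%:E * mu A <= \int[mu]_(x in D) (g x)%:E)%E.
Proof.
move=> mA Aoo /disj_setPS AB AD BD g0 c0 cg.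
have cA : (c%:E * mu A)%E \is a fin_num.
  by rewrite fin_numM// ge0_fin_numE.
rewrite -leeBrDr//; apply: ge0_integral_le_ub => // h hg; rewrite leeBrDr//.
pose h' := add_nnsfun h (scale_nnsfun (indic_nnsfun R mA) c0).
have h0 x : 0 <= h x by exact: fun_ge0.
rewrite -integral_cst_indic// -ge0_integralD//; first last.
- exact: measurable_EFin_cst_indic.
- by move=> x _; rewrite lee_fin mulr_ge0.
- exact: measurable_EFin_nnsfun.
- by move=> x _; rewrite lee_fin.
apply: (@nnsfun_integral_le _ _ h') => // x; have -> : h' x = h x + c * \1_A x by [].
have := hg x; rewrite /patch indicE.
case: ifPn => [/set_mem Bx|Bx] hx.
  have nAx : ~ A x by move=> Ax; apply: (AB x).
  by rewrite (memNset nAx) mulr0 addr0 (mem_set (BD _ Bx)).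
have {hx} -> : h x = 0 by apply/eqP; rewrite eq_le hx h0.
rewrite add0r; case: ifPn => [/set_mem Dx|Dx].
  case: (boolP (x \in A)) => [/set_mem|]; first by rewrite mulr1; exact: cg.
  by rewrite mulr0.
have nAx : ~ A x by move=> /AD /mem_set; exact/negP.
by rewrite (memNset nAx) mulr0.
Qed.
End LowerIntegral.

(** * Lebesgue measure on the plane *)

Lemma measurable_affine {R : realType} (b r : R) :
  measurable_fun [set: measurableTypeR R]
    (fun t : measurableTypeR R => b + r * t : measurableTypeR R).
Proof.
apply: (@continuous_measurable_fun _ (fun t : R => b + r * t)).
move=> x; apply: continuousD; first exact: cvg_cst.
by apply: continuousM => //; exact: cvg_cst.
Qed.

(** The image of Lebesgue measure under the affine map, multiplied by [r], agrees with Lebesgue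
    measure on half-open intervals, hence everywhere by uniqueness. *)
Lemma lebesgue_measure_affine {R : realType} (b r : R)
    (A : set (measurableTypeR R)) : 0 < r -> measurable A ->
  lebesgue_measure A =
  (r%:E * lebesgue_measure ((fun t => b + r * t)%R @^-1` A))%E.
Proof.
move=> r0 mA.
pose f := (fun t : measurableTypeR R => b + r * t : measurableTypeR R).
have mf := measurable_affine b r.
pose m : {measure set (measurableTypeR R) -> \bar R} := pushforward lebesgue_measure f.
pose m' := mscale (NngNum (ltW r0)) (m mf).
rewrite (@lebesgue_measure_unique _ m')// => _ [[x y] _ <-].
suff : lebesgue_measure `]x, y]%classic =
  (r%:E * lebesgue_measure (f @^-1` `]x, y]))%E by [].
have -> : f @^-1` `]x, y] = `](x - b) / r, (y - b) / r]%classic.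
  apply/seteqP; split => t; rewrite /= !in_itv/= /f.
    by rewrite ltr_pdivrMr// ler_pdivlMr//; lra.
  by rewrite ltr_pdivrMr// ler_pdivlMr//; lra.
rewrite !lebesgue_measure_itv/= !lte_fin ltr_pM2r ?invr_gt0// ltrD2r.
case: ifP => _; last by rewrite mule0.
by rewrite -!EFinD -EFinM; congr (_%:E); field; lra.
Qed.

Section PlaneMeasure.
Context {R : realType}.
Implicit Types (A B C : set (plane R)) (c p : R * R) (r s : R).

(** Measurability refers to the product sigma-algebra; an open set is a countable union of products
    of balls with rational centres and radii [1 / (n + 1)]. *)
Lemma open_measurable_plane (A : set (R * R)) :
  open A -> measurable (A : set (plane R)).
Proof.
move=> oA.
pose box (i : rat * rat * nat) : set (R * R) :=
  ball (ratr i.1.1 : R) (i.2.+1%:R^-1) `*` ball (ratr i.1.2 : R) (i.2.+1%:R^-1).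
pose F i := if `[< box i `<=` A >] then box i else set0.
have -> : A = \bigcup_i F i.
  apply/seteqP; split => [[x y] Axy|x [i _]]; last first.
    by rewrite /F; case: asboolP => // + Bx; exact.
  have /open_nbhs_nbhs/nbhs_ballP[e /= e0 eA] : open_nbhs (x, y) A by split.
  have e20 : 0 < e / 2 by rewrite divr_gt0.
  have [n ne] : exists n, n.+1%:R^-1 < e / 2.
    near \oo => n; exists n; near: n; exact: near_infty_natSinv_lt (PosNum e20).
  have n0 : 0 < n.+1%:R^-1 :> R by rewrite invr_gt0.
  have rat_ball z : exists q : rat, `|z - ratr q| < n.+1%:R^-1 :> R.
    move: n0; set a := n.+1%:R^-1 => a0.
    have [|q] := @rat_in_itvoo R (z - a) (z + a); first by lra.
    by rewrite in_itv/= => /andP[? ?]; exists q; rewrite ltr_norml; lra.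
  have [[q qx] [q' qy]] := (rat_ball x, rat_ball y).
  exists (q, q', n) => //; rewrite /F asboolT; last first.
    move=> [x' y'] [/=]; rewrite -!ball_normE/= => qx' qy'; apply: eA.
    move: (n.+1%:R^-1 : R) ne qx qy qx' qy' => a ae qx qy qx' qy'.
    split; rewrite -ball_normE/=.
      have -> : x - x' = (x - ratr q) + (ratr q - x') by ring.
      rewrite (le_lt_trans (ler_normD _ _))//. lra.
    have -> : y - y' = (y - ratr q') + (ratr q' - y') by ring.
    by rewrite (le_lt_trans (ler_normD _ _))//; lra.
  by split => /=; rewrite -ball_normE/= distrC.
apply: countable_bigcupT_measurable; first exact: countableP.
move=> i; rewrite /F; case: asboolP => _ //.
by apply: measurableX; apply: open_measurable; exact: ball_open.
Unshelve. all: by end_near. Qed.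

Lemma lebesgue2X (A B : set (measurableTypeR R)) : measurable A -> measurable B ->
  lebesgue2 (A `*` B) = (lebesgue_measure A * lebesgue_measure B)%E.
Proof. exact: product_measure1E. Qed.

Lemma measurable_homothety c r :
  measurable_fun [set: plane R] (fun x : plane R => (c + r *: (x : R * R)) : plane R).
Proof.
apply/measurable_fun_pairP; split => /=.
- apply: (@measurableT_comp _ _ _ _ _ _ (fun t => c.1 + r * t) _ fst) => //.
  exact: measurable_affine.
- apply: (@measurableT_comp _ _ _ _ _ _ (fun t => c.2 + r * t) _ snd) => //.
  exact: measurable_affine.
Qed.

Lemma lebesgue2_homothety_preimage c r A : 0 < r -> measurable A ->
  lebesgue2 A = ((r ^+ 2)%:E * lebesgue2 ((fun x : R * R => c + r *: x)%R @^-1` A))%E.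
Proof.
move=> r0 mA.
pose f := (fun x : plane R => (c + r *: (x : R * R))%R : plane R).
have mf := measurable_homothety c r.
pose m : {measure set (plane R) -> \bar R} := pushforward (@lebesgue2 R) f.
pose m' := mscale (NngNum (sqr_ge0 r)) (m mf).
rewrite {1}/lebesgue2
  (@product_measure_unique _ _ _ _ R lebesgue_measure lebesgue_measure m')//.
move=> X Y mX mY.
suff : ((r ^+ 2)%:E * lebesgue2 (f @^-1` (X `*` Y)) =
  lebesgue_measure X * lebesgue_measure Y)%E by [].
have -> : f @^-1` (X `*` Y) =
  ((fun t => c.1 + r * t)%R @^-1` X) `*` ((fun t => c.2 + r * t)%R @^-1` Y).
  by [].
rewrite lebesgue2X; last 2 first.
- by rewrite -[X in measurable X]setTI; exact: measurable_affine.
- by rewrite -[X in measurable X]setTI; exact: measurable_affine.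
rewrite (lebesgue_measure_affine c.1 r0 mX) (lebesgue_measure_affine c.2 r0 mY).
by rewrite muleACA -EFinM expr2.
Qed.

Lemma homothety_image c r (A : set (R * R)) : r != 0 ->
  (fun x => c + r *: x) @` A =
  (fun x => - (r^-1 *: c) + r^-1 *: x) @^-1` A.
Proof.
move=> r0; apply/seteqP; split => [_ [x Ax <-]|x Ax] /=.
  by rewrite scalerDr scalerA mulVf// scale1r addKr.
eexists; first exact: Ax.
by rewrite scalerDr scalerN !scalerA mulfV// !scale1r addNKr.
Qed.

Lemma measurable_homothety_image c r A : r != 0 -> measurable A ->
  measurable ((fun x : R * R => c + r *: x) @` A : set (plane R)).
Proof.
move=> r0 mA; rewrite homothety_image// -[X in measurable X]setTI.
exact: measurable_homothety.
Qed.

Lemma lebesgue2_homothety c r A : 0 < r -> measurable A ->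
  lebesgue2 ((fun x : R * R => c + r *: x)%R @` A) = ((r ^+ 2)%:E * lebesgue2 A)%E.
Proof.
move=> r0 mA; rewrite homothety_image ?gt_eqF//.
rewrite (@lebesgue2_homothety_preimage (- (r^-1 *: c))%R r^-1 A) ?invr_gt0//.
by rewrite muleA -EFinM -exprMn mulfV ?gt_eqF// expr1n mul1e.
Qed.

Lemma lebesgue2_open_gt0 (A : set (R * R)) : open A -> A !=set0 ->
  (0 < lebesgue2 A)%E.
Proof.
move=> oA [x Ax].
have /open_nbhs_nbhs/nbhs_ballP[e /= e0 eA] : open_nbhs x A by split.
have mb (z : R) : measurable (ball z e : set (measurableTypeR R)).
  by apply: open_measurable; exact: ball_open.
apply: (@lt_le_trans _ _ (lebesgue2 (ball x.1 e `*` ball x.2 e : set (plane R)))).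
  rewrite lebesgue2X// !lebesgue_measure_ball ?ltW//.
  by rewrite -EFinM lte_fin mulr_gt0// mulrn_wgt0.
apply: le_measure => //; rewrite ?inE.
- exact: measurableX.
- exact: open_measurable_plane.
Qed.

Lemma closed_measurable_plane (A : set (R * R)) :
  closed A -> measurable (A : set (plane R)).
Proof.
move=> /closed_openC/open_measurable_plane mA.
by rewrite -(setCK A); exact: measurableC.
Qed.

Lemma compact_lebesgue2_fin (A : set (R * R)) : compact A ->
  (lebesgue2 A < +oo)%E.
Proof.
move=> cA; have [N [_ AN]] := compact_bounded cA.
have {}AN x : A x -> `|x| <= N + 1 by apply: AN; rewrite ltrDl.
pose I : set (measurableTypeR R) := `[- (N + 1), N + 1]%classic.
have mI : measurable I by exact: measurable_itv.
apply: (@le_lt_trans _ _ (lebesgue2 (I `*` I))).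
  apply: le_measure; rewrite ?inE.
  - by apply: closed_measurable_plane; exact: compact_closed.
  - exact: (measurableX mI mI).
  - move=> x /AN; rewrite prod_normE ge_max => /andP[x1 x2].
    by split; rewrite /I/= in_itv/= -ler_norml.
rewrite lebesgue2X// lebesgue_measure_itv/=.
by case: ifP => _; rewrite ?mule0// -EFinD -EFinM ltry.
Qed.

(* Scaling towards [p] by factors tending to 1 exhausts the measure of [C]. *)
Lemma lebesgue2_setD_null p A C : measurable A -> measurable C -> A `<=` C ->
  (lebesgue2 C < +oo)%E ->
  (forall s x, 0 < s < 1 -> C x -> A ((1 - s) *: p + s *: (x : R * R))) ->
  lebesgue2 (C `\` A) = 0%E.
Proof.
move=> mA mC AC Coo sCA.
have Aoo : (lebesgue2 A < +oo)%E.
  by apply: le_lt_trans Coo; apply: le_measure; rewrite ?inE.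
have [a aE] : exists a : R, lebesgue2 A = a%:E.
  by exists (fine (lebesgue2 A)); rewrite fineK// ge0_fin_numE.
have [c cE] : exists c : R, lebesgue2 C = c%:E.
  by exists (fine (lebesgue2 C)); rewrite fineK// ge0_fin_numE.
have a0 : 0 <= a by rewrite -lee_fin -aE.
have ac : a <= c by rewrite -lee_fin -aE -cE; apply: le_measure; rewrite ?inE.
have sca s : 0 < s < 1 -> s ^+ 2 * c <= a.
  move=> s01; have s0 : 0 < s by case/andP: s01.
  rewrite -lee_fin EFinM -cE -aE -(lebesgue2_homothety ((1 - s) *: p) s0 mC).
  apply: le_measure; rewrite ?inE//.
    exact: (measurable_homothety_image _ (lt0r_neq0 s0) mC).
  by move=> _ [x Cx <-]; exact: sCA.
suff ca : c = a.
  have -> : lebesgue2 (C `\` A) = (lebesgue2 C - lebesgue2 (C `&` A))%E.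
    exact: (measureD (mu := @lebesgue2 R) mC mA Coo).
  by rewrite (setIidr AC) cE aE ca -EFinB subrr.
apply/eqP; rewrite eq_le ac andbT leNgt; apply/negP => lt_ac {Aoo Coo aE cE}.
have c0 : 0 < c by exact: le_lt_trans lt_ac.
(* With this [t], [(1 - t) ^+ 2 * c] is at least [c - 2 * (t * c)], the midpoint of [a] and [c],
   which exceeds [a]. *)
pose t := (c - a) / (4 * c).
have t0 : 0 < t by rewrite divr_gt0//; lra.
have t1 : t <= 4^-1 by rewrite ler_pdivrMr; lra.
have tc : t * c = (c - a) / 4 by rewrite /t; field; lra.
have /sca : 0 < 1 - t < 1 by lra.
have -> : (1 - t) ^+ 2 * c = c - 2 * (t * c) + t * (t * c) by ring.
have := mulr_ge0 (ltW t0) (mulr_ge0 (ltW t0) (ltW c0)).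
by rewrite tc; lra.
Qed.
End PlaneMeasure.

(** * Concave functions and their gradients *)

Section Concave.
Context {R : realType}.

Lemma convex_setP (M : lmodType R) (A : set M) :
  convex_set A <->
  forall s x y, 0 <= s <= 1 -> A x -> A y -> A ((1 - s) *: x + s *: y).
Proof.
split=> [cA s x y /andP[s0 s1] Ax Ay|cA x y t /set_mem Ax /set_mem Ay].
  have := cA y x (Itv01 s0 s1); rewrite !inE => /(_ Ay Ax).
  by rewrite /conv/= addrC.
rewrite inE; have := cA t%:num y x; rewrite addrC; apply=> //.
by rewrite ge0 le1.
Qed.

Lemma concave_functionP (A : set (R * R)) (u : R * R -> R) :
  concave_function A u <->
  forall s x y, 0 <= s <= 1 -> A x -> A y ->
    (1 - s) * u x + s * u y <= u ((1 - s) *: x + s *: y).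
Proof.
split=> [cu s x y /andP[s0 s1] Ax Ay|cu t x y /set_mem Ax /set_mem Ay].
  have := cu (Itv01 s0 s1) y x; rewrite !inE => /(_ Ay Ax).
  rewrite /= convRE /conv/= /unstable.onem/= addrC.
  by rewrite !mulrN -opprD lerN2 [X in X <= _]addrC.
have := cu t%:num y x; rewrite ge0 le1 => /(_ isT Ay Ax).
rewrite /= convRE /conv/= /unstable.onem/= => cuxy.
rewrite !mulrN -opprD lerN2.
by rewrite addrC [X in _ <= u X]addrC.
Qed.

Lemma dotpD (a x y : R * R) : dotp a (x + y) = dotp a x + dotp a y.
Proof. by rewrite /dotp/=; ring. Qed.

Lemma dotpZ (a x : R * R) (r : R) : dotp a (r *: x) = r * dotp a x.
Proof. by rewrite /dotp/= /GRing.scale/=; ring. Qed.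

Lemma dotpZl (a x : R * R) (r : R) : dotp (r *: a) x = r * dotp a x.
Proof. by rewrite /dotp/= /GRing.scale/=; ring. Qed.

Lemma dotp_continuous (a : R * R) : continuous (dotp a).
Proof.
move=> x; rewrite /dotp; apply: cvgD; apply: cvgM;
  [exact: cvg_cst|exact: cvg_fst|exact: cvg_cst|exact: cvg_snd].
Qed.

Lemma grad_affine (a x : R * R) (b : R) : grad (fun y => dotp a y + b) x = a.
Proof.
have lin_a : linear (dotp a) by move=> r y z; rewrite dotpD dotpZ.
pose da := GRing.isLinear.Build R (R * R)%type R *:%R (dotp a) lin_a.
pose df : {linear (R * R)%type -> R} := HB.pack (dotp a) da.
have -> : grad (fun y => dotp a y + b) x = (df (1, 0), df (0, 1)).
  rewrite /grad (@diff_unique _ _ _ _ df)//; first exact: dotp_continuous.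
  apply/eqaddoP => e e0; near=> h.
  rewrite !fctE/= dotpD (_ : _ - _ = 0) ?normr0 ?(mulr_ge0 (ltW e0))//.
  by ring.
rewrite /= /dotp/= !mulr1 !mulr0 add0r addr0; by case: a {da df lin_a}.
Unshelve. all: by end_near. Qed.

(** ['d f x] comes from a choice operator whose default value is the zero map. *)
Lemma diff_junk (V W : normedModType R) (f : V -> W) (x : V) :
  ~ differentiable f x -> 'd f x = \0 :> (V -> W).
Proof.
move=> ndf; have [edf|ndf'] := pselect (exists df : {linear V -> W},
  continuous df /\ forall y, f y = f (lim (nbhs_filter_on x))
    + df (y - lim (nbhs_filter_on x))
    +o_(y \near nbhs_filter_on x) (y - lim (nbhs_filter_on x))).
  by case: ndf; apply/diffP; exact: getPex edf.
by rewrite /diff getPN// => df dfP; apply: ndf'; exists df.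
Qed.

(** If either function is differentiable at [x], uniqueness of the differential applies; if neither
    is, both gradients are the junk value. *)
Lemma near_grad (u v : R * R -> R) (x : R * R) :
  (\forall y \near x, u y = v y) -> grad u x = grad v x.
Proof.
have H (f g : R * R -> R) : (\forall y \near x, f y = g y) ->
    differentiable f x -> grad f x = grad g x.
  move=> fg df; rewrite /grad (@diff_unique _ _ _ g ('d f x))//.
    exact: diff_continuous.
  have fgx : f x = g x by exact: nbhs_singleton fg.
  have [_ /funext/eqaddoP fE] := (diff_locallyxP x f).1 df.
  have {}fg : \forall h \near (0 : (R * R)%type), f (h + x) = g (h + x).
    by move: fg; rewrite (near_shift 0) subr0.
  apply/eqaddoP => e e0; near=> h.
  have ghx : g (h + x) = f (h + x) by symmetry; near: h.
  rewrite !fctE/= -fgx ghx.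
  by near: h; have := fE _ e0; rewrite !fctE.
move=> uv; have vu : \forall y \near x, v y = u y by exact: filterS uv.
have [du|ndu] := pselect (differentiable u x); first exact: H.
have [dv|ndv] := pselect (differentiable v x); first by symmetry; exact: H.
by rewrite /grad !diff_junk.
Unshelve. all: by end_near. Qed.
End Concave.

(** * Gradient bounds and interior continuity of concave functions *)

Section ConcaveRegularity.
Context {R : realType}.
Implicit Types (A : set (R * R)) (u : R * R -> R) (x v : R * R).

Lemma enorm0 : enorm (0 : R * R) = 0.
Proof. by rewrite /enorm/= expr0n/= addr0 sqrtr0. Qed.

Lemma enormZ (r : R) x : 0 <= r -> enorm (r *: x) = r * enorm x.
Proof.
move=> r0; rewrite /enorm/= /GRing.scale/= !exprMn -mulrDr sqrtrM ?sqr_ge0//.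
by rewrite sqrtr_sqr ger0_norm.
Qed.

Lemma enorm_gt0 x : x != 0 -> 0 < enorm x.
Proof.
move=> x0; rewrite sqrtr_gt0 lt_neqAle eq_sym paddr_eq0 ?sqr_ge0//.
rewrite addr_ge0 ?sqr_ge0// andbT !sqrf_eq0; apply: contra x0.
by case: x => a b /= /andP[/eqP-> /eqP->].
Qed.

Lemma enorm_le x : enorm x <= `|x.1| + `|x.2|.
Proof.
rewrite -[leRHS]ger0_norm ?addr_ge0// -sqrtr_sqr ler_wsqrtr//.
by rewrite sqrrD !real_normK ?num_real// lerD2r lerDl mulrn_wge0// mulr_ge0.
Qed.

(** For [h] in [(0, 1)] the difference quotient at [h] is at least the full increment; let [h] tend
    to 0 from the right. *)
Lemma concave_diff_ge A u x v : concave_function A u -> A x -> A (x + v) ->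
  differentiable u x -> u (x + v) - u x <= 'd u x v.
Proof.
move=> /concave_functionP cu Ax Axv du; rewrite -deriveE//.
have /cvg_dnbhs_at_right cq :
    h^-1 *: ((u \o shift x) (h *: v) - u x) @[h --> 0^'] --> 'D_v u x.
  exact: diff_derivable.
rewrite -(cvg_lim _ cq)//; apply: limr_ge; first by apply/cvg_ex; eexists; exact: cq.
near=> h; have h0 : 0 < h by near: h; exact: nbhs_right_gt.
have h1 : h < 1 by near: h; exact: nbhs_right_lt.
have := cu h x (x + v); rewrite (ltW h0) (ltW h1) => /(_ isT Ax Axv).
have -> : (1 - h) *: x + h *: (x + v) = h *: v + x.
  by rewrite scalerDr scalerBl scale1r addrA subrK addrC.
rewrite /= /GRing.scale/= => H.
rewrite -(ler_pM2l h0) mulrA mulfV ?gt_eqF// mul1r; lra.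
Unshelve. all: by end_near. Qed.

(** Steps of length [rho] either way along a coordinate axis change [u] by at least [- o], and the
    differential dominates these increments; each partial derivative is thus at most [o / rho] in
    absolute value. *)
Lemma concave_grad_le A u x (rho m o : R) : concave_function A u ->
  0 < rho -> 0 <= o ->
  (forall y, `|y - x| <= rho -> A y /\ m <= u y) -> u x <= m + o ->
  enorm (grad u x) <= 2 * (o / rho).
Proof.
move=> cu rho0 o0 Au ux.
have [du|ndu] := pselect (differentiable u x); last first.
  rewrite /grad diff_junk//= enorm0.
  by rewrite mulr_ge0// divr_ge0// ltW.
have rNZ (r : R) (e : R * R) : `|e| = 1 -> `|r| = rho -> - o <= r * 'd u x e.
  move=> e1 r1.
  have [Ax _] : A x /\ m <= u x by apply: Au; rewrite subrr normr0 ltW.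
  have [Axe um] : A (x + r *: e) /\ m <= u (x + r *: e).
    by apply: Au; rewrite addrC addKr normrZ e1 r1 mulr1.
  have := concave_diff_ge cu Ax Axe du; rewrite linearZ/= /GRing.scale/= => H; lra.
have dle (e : R * R) : `|e| = 1 -> `|'d u x e| <= o / rho.
  move=> e1; rewrite ler_pdivlMr// mulrC.
  have := rNZ rho e e1; rewrite gtr0_norm// => /(_ erefl) H1.
  have := rNZ (- rho) e e1; rewrite normrN gtr0_norm// => /(_ erefl) H2.
  rewrite -{1}(gtr0_norm rho0) -normrM ler_norml; lra.
rewrite (le_trans (enorm_le _))//= mulr_natl mulr2n lerD// dle// prod_normE/=.
- by rewrite normr1 normr0 maxEle ler10.
- by rewrite normr1 normr0 maxEle ler01.
Qed.

(** The line through [x] and [y] is prolonged to [x + w] and [x - w] inside the ball; concavity on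
    [[x, x + w]] bounds [u y] from below, and on [[y, x - w]] from above. *)
Lemma concave_continuous A u x (M : R) : concave_function A u ->
  (forall y, A y -> 0 <= u y <= M) -> A° x -> {for x, continuous u}.
Proof.
move=> /concave_functionP cu uM /nbhs_ballP[r /= r0 rA].
have Ax : A x by apply: rA; exact: ballxx.
have rA' y : `|x - y| < r -> A y by move=> xy; apply: rA; rewrite -ball_normE.
have M0 : 0 <= M by have /andP[] := uM _ Ax; exact: le_trans.
have H (t : R) y : 0 < t <= 1 -> `|y - x| < t * r -> `|u x - u y| <= t * M.
  move=> /andP[t0 t1] xy; pose w := t^-1 *: (y - x).
  have wr : `|w| < r.
    by rewrite /w normrZ gtr0_norm ?invr_gt0// mulrC ltr_pdivrMr// mulrC.
  have Az : A (x + w) by apply: rA'; rewrite opprD addrA subrr add0r normrN.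
  have Az' : A (x - w) by apply: rA'; rewrite opprB addrCA subrr addr0.
  have Ay : A y.
    by apply: rA'; rewrite distrC (lt_le_trans xy)// ler_piMl// ltW.
  have tw : t *: w = y - x by rewrite /w scalerA mulfV ?gt_eqF// scale1r.
  have := cu t x (x + w); rewrite (ltW t0) t1 => /(_ isT Ax Az).
  have -> : (1 - t) *: x + t *: (x + w) = y.
    by rewrite scalerDr scalerBl scale1r addrA subrK tw addrCA subrr addr0.
  (* The weight solving [x = (1 - s) *: y + s *: (x - w)]. *)
  move=> H1; pose s := t / (1 + t).
  have t10 : 0 < 1 + t by lra.
  have s01 : 0 <= s <= 1.
    by rewrite divr_ge0/= ?(ltW t0) ?(ltW t10)// ler_pdivrMr//; lra.
  have s1 : 1 - s = (1 + t)^-1 by rewrite /s; field; lra.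
  have := cu s y (x - w) s01 Ay Az'.
  have -> : (1 - s) *: y + s *: (x - w) = x.
    have -> : x - w = (1 + t^-1) *: x - t^-1 *: y.
      by rewrite /w scalerBr scalerDl scale1r opprB addrA.
    rewrite scalerBr !scalerA addrCA -scalerBl.
    have -> : s * (1 + t^-1) = 1 by rewrite /s; field; lra.
    have -> : 1 - s - s * t^-1 = 0 by rewrite /s; field; lra.
    by rewrite scale1r scale0r addr0.
  rewrite s1 => H2.
  have [/andP[x0 xM] /andP[y0 yM]] := (uM _ Ax, uM _ Ay).
  have [/andP[z0 zM] /andP[z'0 z'M]] := (uM _ Az, uM _ Az').
  have H3 : u y <= (1 + t) * u x.
    rewrite -ler_pdivrMl//; apply: le_trans H2; rewrite lerDl mulr_ge0//.
    by case/andP: s01.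
  have := ler_wpM2l (ltW t0) xM; have := mulr_ge0 (ltW t0) z0.
  rewrite ler_norml; lra.
apply/cvgrPdist_lt => e e0.
pose t := Num.min 1 (e / (M + 1) / 2).
have t0 : 0 < t by rewrite lt_min ltr01/= !divr_gt0//; lra.
have t1 : t <= 1 by rewrite ge_min lexx.
have tM : t * M < e.
  have : t <= e / (M + 1) / 2 by rewrite ge_min lexx orbT.
  rewrite ler_pdivlMr// ler_pdivlMr; last by lra.
  have := mulr_ge0 (ltW t0) M0; lra.
have : \forall y \near x, `|x - y| < t * r.
  apply/nbhs_ballP; exists (t * r) => [|y]; rewrite ?/=?mulr_gt0//.
  by rewrite -ball_normE.
apply: filterS => y xy; apply: le_lt_trans tM; apply: H; first by rewrite t0.
by rewrite distrC.
Qed.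
End ConcaveRegularity.

(** * Truncating a minimizer by an affine function *)

Section EnergyComparison.
Context {R : realType}.
Implicit Types (Omega : set (R * R)) (f u : R * R -> R) (x y p : R * R).

(** The growth condition with [N = 1] and first point 0 bounds [f] far from the origin by
    [f 0 * delta]; compactness of a square does the rest. Boundedness makes energies finite. *)
Lemma growth_bounded f : (forall x, 0 < f x) -> continuous f ->
  growth_condition f -> exists2 C : R, 0 <= C & forall x, f x <= C.
Proof.
move=> f0 cf gf; have [delta delta0 fd] := gf 1 ltr01.
pose r := delta^-1 + 1.
have d'0 : 0 < delta^-1 by rewrite invr_gt0.
pose B : set (R * R) := `[- r, r]%classic `*` `[- r, r]%classic.
have cB : compact (f @` B).
  apply: continuous_compact; first exact: continuous_subspaceT.
  by apply: compact_setX; exact: segment_compact.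
have [N [_ fN]] := compact_bounded cB.
pose C := Num.max (N + 1) (f 0 * delta).
have C0 : 0 <= C by rewrite le_max [X in _ || X]mulr_ge0 ?orbT// ltW.
exists C => // x; rewrite le_max.
have [xr|xr] := leP `|x| r.
  rewrite (le_trans (ler_norm _)) ?orTb//; apply: (fN (N + 1)) => //.
    by rewrite ltrDl.
  exists x => //; move: xr; rewrite prod_normE ge_max => /andP[x1 x2].
  by split; rewrite /= in_itv/= -ler_norml.
apply/orP; right; have xe : r < enorm x.
  apply: lt_le_trans xr _; rewrite prod_normE ge_max -!sqrtr_sqr.
  by rewrite !ler_wsqrtr// ?lerDl ?lerDr sqr_ge0.
have e0 : 0 < enorm x by apply: lt_trans xe; rewrite addr_gt0.
have x0 : x != 0 by apply: contraTneq e0 => ->; rewrite enorm0 ltxx.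
have := fd 0 x x0; rewrite enorm0 addr0 mul1r.
have ide : (enorm x)^-1 < delta.
  rewrite -[ltRHS]invrK ltf_pV2 ?posrE//; apply: le_lt_trans xe.
  by rewrite lerDl.
move=> /(_ ide); rewrite mul1r ltr_pdivlMr ?mulr_gt0// mul1r => H.
move: H; rewrite -ltr_pdivlMl// => /ltW/le_trans; apply.
by rewrite mulrC ler_wpM2l ?(ltW (f0 0)) ?(ltW ide).
Qed.

(** A displacement of the convex combination by at most [lam * rho] is absorbed by moving the
    endpoint [p] by at most [rho]. *)
Lemma convex_set_ball Omega p x y (rho lam : R) : convex_set Omega ->
  (forall z, `|z - p| <= rho -> Omega z) -> Omega x -> 0 < lam <= 1 ->
  `|y - ((1 - lam) *: x + lam *: p)| <= lam * rho ->
  exists2 z, Omega z & y = (1 - lam) *: x + lam *: z.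
Proof.
move=> cO pO Ox /andP[l0 l1] yr.
pose w := y - ((1 - lam) *: x + lam *: p).
exists (p + lam^-1 *: w).
  apply: pO; rewrite addrC addKr normrZ gtr0_norm ?invr_gt0// mulrC.
  by rewrite ler_pdivrMr// mulrC.
rewrite scalerDr scalerA mulfV ?gt_eqF// scale1r addrA /w.
by rewrite addrCA subrr addr0.
Qed.

Lemma interior_ball_le Omega p : Omega° p ->
  exists2 r : R, 0 < r & forall y, `|y - p| <= r -> Omega y.
Proof.
move=> /nbhs_ballP[r /= r0 rO]; exists (r / 2); first by rewrite divr_gt0.
move=> y yp; apply: rO; rewrite -ball_normE/= distrC (le_lt_trans yp)//.
by rewrite ltr_pdivrMr// ltr_pMr// ltr1n.
Qed.

Lemma ball_le_interior Omega p (r : R) : 0 < r ->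
  (forall y, `|y - p| <= r -> Omega y) -> Omega° p.
Proof.
move=> r0 rO; apply/nbhs_ballP; exists r => //= y.
by rewrite -ball_normE/= distrC => /ltW; exact: rO.
Qed.

Lemma convex_interior Omega p x (s : R) : convex_set Omega ->
  Omega° p -> Omega x -> 0 < s <= 1 -> Omega° ((1 - s) *: x + s *: p).
Proof.
move=> cO /interior_ball_le[r r0 rO] Ox s01.
have /andP[s0 s1] := s01.
apply: (@ball_le_interior _ _ (s * r)); first exact: mulr_gt0.
move=> y /(convex_set_ball cO rO Ox s01)[z Oz ->].
by apply: (convex_setP _).1 => //; rewrite ltW.
Qed.

(** Scaling towards an interior point by a factor below 1 maps [Omega] into its interior. *)
Lemma lebesgue2_convex_boundary_null Omega : compact Omega ->
  convex_set Omega -> Omega° !=set0 ->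
  lebesgue2 (Omega `\` Omega° : set (plane R)) = 0%E.
Proof.
move=> kO cO [p Op].
have mO : measurable (Omega : set (plane R)).
  by apply: closed_measurable_plane; exact: compact_closed.
apply: (@lebesgue2_setD_null _ p) => //.
- by apply: open_measurable_plane; exact: open_interior.
- exact: interior_subset.
- exact: compact_lebesgue2_fin.
- move=> s x /andP[s0 s1] Ox; rewrite addrC.
  have -> : s *: (x : R * R) = (1 - (1 - s)) *: (x : R * R) by rewrite subKr.
  by apply: convex_interior => //; lra.
Qed.

Lemma min_affine_admissible Omega M u (b : R * R) (c : R) :
  (forall x, Omega x -> 0 <= dotp b x + c) -> admissible Omega M u ->
  admissible Omega M (fun x => Num.min (u x) (dotp b x + c)).
Proof.
move=> l0 [/concave_functionP cu uM]; split; last first.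
  move=> x Ox; have /andP[u0 uxM] := uM _ Ox.
  by rewrite le_min u0 l0//= ge_min uxM.
apply/concave_functionP => s x y s01 Ox Oy; have /andP[s0 s1] := s01.
have s10 : 0 <= 1 - s by rewrite subr_ge0.
rewrite le_min; apply/andP; split.
  apply: le_trans (cu s x y s01 Ox Oy).
  by apply: lerD; apply: ler_wpM2l => //; rewrite ge_min lexx.
rewrite dotpD !dotpZ.
have -> : (1 - s) * dotp b x + s * dotp b y + c =
  (1 - s) * (dotp b x + c) + s * (dotp b y + c) by ring.
by apply: lerD; apply: ler_wpM2l => //; rewrite ge_min lexx orbT.
Qed.

(** * Comparison of a minimizer with its minimum with an affine function *)

Section Truncation.
Variables (Omega : set (R * R)) (M : R) (f u : R * R -> R) (b : R * R) (c : R).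
Hypotheses (kO : compact Omega) (cO : convex_set Omega).
Hypotheses (f0 : forall x, 0 < f x) (cf : continuous f).
Hypotheses (gf : growth_condition f) (umin : minimizer Omega M f u).
Hypothesis l0 : forall x, Omega x -> 0 <= dotp b x + c.

Let l x := dotp b x + c.
(** Restriction to the interior, where [u] is continuous, makes [A] and [B] open: they are then
    measurable, and gradients can be compared locally on them. *)
Let A := [set x | Omega° x /\ l x < u x].
Let B := [set x | Omega° x /\ u x < l x].

Let cl : continuous l.
Proof. by move=> x; apply: cvgD; [exact: dotp_continuous|exact: cvg_cst]. Qed.

Let near_above x : A x -> \forall y \near x, l y < u y.
Proof.
move=> [Ox lux]; have cu := concave_continuous umin.1.1 umin.1.2 Ox.
have : (fun y => u y - l y) y @[y --> x] --> u x - l x.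
  by apply: cvgB => //; exact: cl.
move=> /cvgr_gt/(_ 0); rewrite subr_gt0 => /(_ lux).
by apply: filterS => y; rewrite subr_gt0.
Qed.

Let near_below x : B x -> \forall y \near x, u y < l y.
Proof.
move=> [Ox lux]; have cu := concave_continuous umin.1.1 umin.1.2 Ox.
have : (fun y => l y - u y) y @[y --> x] --> l x - u x.
  by apply: cvgB => //; exact: cl.
move=> /cvgr_gt/(_ 0); rewrite subr_gt0 => /(_ lux).
by apply: filterS => y; rewrite subr_gt0.
Qed.

Let oA : open A.
Proof.
rewrite openE => x Ax; rewrite /interior.
have := near_above Ax; have := open_interior Omega; rewrite openE => /(_ _ Ax.1).
exact: filterI.
Qed.

Let oB : open B.
Proof.
rewrite openE => x Bx; rewrite /interior.
have := near_below Bx; have := open_interior Omega; rewrite openE => /(_ _ Bx.1).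
exact: filterI.
Qed.

Let mO : measurable (Omega : set (plane R)).
Proof. by apply: closed_measurable_plane; exact: compact_closed. Qed.

Let mIO : measurable (Omega° : set (plane R)).
Proof. by apply: open_measurable_plane; exact: open_interior. Qed.

Let mA : measurable (A : set (plane R)).
Proof. exact: open_measurable_plane. Qed.

Let mB : measurable (B : set (plane R)).
Proof. exact: open_measurable_plane. Qed.

(** The concave function [u - l] is positive at a point [p] of [A] and nonnegative on the interior
    off [B], hence positive strictly between; scaling towards [p] thus lands in [A]. *)
Let contact_null : A !=set0 ->
  lebesgue2 ((Omega° `\` B) `\` A : set (plane R)) = 0%E.
Proof.
move=> [p [Op lup]]; apply: (@lebesgue2_setD_null _ p) => //.
- exact: measurableD.
- by move=> x [Ox lux]; split=> // -[_]; rewrite ltNge (ltW lux).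
- apply: le_lt_trans (compact_lebesgue2_fin kO); apply: le_measure; rewrite ?inE//.
    exact: measurableD.
  by move=> x [+ _]; exact: interior_subset.
- move=> s x /andP[s0 s1] [Ox nBx]; have lux : l x <= u x.
    by rewrite leNgt; apply/negP => ulx; exact: nBx.
  have Os : (fun x => Omega x) x := interior_subset Ox.
  split.
    rewrite addrC.
    have -> : s *: (x : R * R) = (1 - (1 - s)) *: (x : R * R) by rewrite subKr.
    by apply: convex_interior => //; lra.
  have /concave_functionP cu := umin.1.1.
  apply: lt_le_trans (cu s p x _ (interior_subset Op) Os); last by rewrite !ltW.
  rewrite /l dotpD !dotpZ.
  have -> : (1 - s) * dotp b p + s * dotp b x + c =
    (1 - s) * l p + s * l x by rewrite /l; ring.
  by rewrite ltr_leD// ?ltr_pM2l ?subr_gt0// ler_wpM2l// ltW.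
Qed.

Lemma measurable_above :
  measurable ([set x | Omega° x /\ dotp b x + c < u x] : set (plane R)).
Proof. exact: mA. Qed.

(** The competitor, the minimum of [u] and [l], has the gradient of [u] on [B] and gradient [b] on
    [A]; the rest of [Omega] is null. Once the energy on [B] is cancelled, the contribution of [D]
    to the energy of [u] is compared with that of [A] to the competitor. *)
Lemma minimizer_truncation (D : set (R * R)) (k : R) :
  measurable (D : set (plane R)) ->
  D `<=` [set x | Omega° x /\ dotp b x + c < u x] ->
  0 <= k -> (forall x, D x -> k <= f (grad u x)) ->
  (k%:E * lebesgue2 (D : set (plane R)) <= (f b)%:E *
    lebesgue2 ([set x | Omega° x /\ dotp b x + c < u x]%R : set (plane R)))%E.
Proof.
(* [contact_null] requires a point of [A], which a nonempty [D] provides. *)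
move=> mD DA k0 kf; have [->|/set0P [q Dq]] := eqVneq D set0.
  have -> : lebesgue2 (set0 : set (plane R)) = 0%E := measure0 (@lebesgue2 R).
  by rewrite mule0 mule_ge0// lee_fin ltW.
have A0 : A !=set0 by exists q; exact: DA.
pose v x := Num.min (u x) (l x).
have vadm : admissible Omega M v by exact: min_affine_admissible l0 umin.1.
have Ooo := compact_lebesgue2_fin kO.
have AO : A `<=` Omega by move=> x [+ _]; exact: interior_subset.
have BO : B `<=` Omega by move=> x [+ _]; exact: interior_subset.
have [C C0 fC] := growth_bounded f0 cf gf.
pose N := (Omega `\` Omega°) `|` ((Omega° `\` B) `\` A).
have m1 : measurable (Omega `\` Omega° : set (plane R)) by exact: measurableD.
have m2 : measurable ((Omega° `\` B) `\` A : set (plane R)).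
  by apply: measurableD => //; exact: measurableD.
have mN : measurable (N : set (plane R)) by exact: (measurableU _ _ m1 m2).
have N0 : lebesgue2 (N : set (plane R)) = 0%E.
  rewrite -(@lebesgue2_convex_boundary_null Omega)//; last first.
    by exists q; have [] := DA _ Dq.
  exact: (measureU0 (mu := @lebesgue2 R) m1 m2 (contact_null A0)).
have fg0 w x : 0 <= f (grad w x) by exact: ltW.
have Ev : (energy Omega f v <=
    \int[lebesgue2]_(x in B) (f (grad v x))%:E +
      (f b)%:E * lebesgue2 (A : set (plane R)))%E.
  apply: (@ge0_integral_le_split _ _ _ (@lebesgue2 R) Omega A B N) => //.
  - move=> x Ox; have [Ix|nIx] := pselect (Omega° x); last by right; left.
    have [lu|ul|e] := ltgtP (l x) (u x).
    + by left; right.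
    + by left; left.
    + right; right; split; first split=> // -[_]; rewrite ?e ?ltxx//.
      by move=> [_]; rewrite e ltxx.
  - exact: ltW.
  - move=> x Ax; rewrite (@near_grad _ v l) ?grad_affine//.
    apply: filterS (near_above Ax) => y luy.
    by rewrite /v minEle leNgt luy.
have Ediff : (\int[lebesgue2]_(x in B) (f (grad v x))%:E =
    \int[lebesgue2]_(x in B) (f (grad u x))%:E)%E.
  apply: eq_integral => x /set_mem Bx; congr (f _)%:E.
  apply: near_grad; apply: filterS (near_below Bx) => y uly.
  by rewrite /v minEle (ltW uly).
have DO : D `<=` Omega by apply: subset_trans AO.
have Doo : (lebesgue2 (D : set (plane R)) < +oo)%E.
  by apply: le_lt_trans Ooo; apply: le_measure; rewrite ?inE.
have Eu : (\int[lebesgue2]_(x in B) (f (grad u x))%:E +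
    k%:E * lebesgue2 (D : set (plane R)) <= energy Omega f u)%E.
  have DB : [disjoint (D : set (plane R)) & B].
    by apply/disj_setPS => x [/DA[_ lu] [_]]; rewrite ltNge (ltW lu).
  exact: (ge0_integral_ge_split (mu := @lebesgue2 R)
    (g := fun x => f (grad u x)) mD Doo DB DO BO (fg0 u) k0 kf).
(* The energy on [B] can be cancelled because it is finite: [f] is bounded and [Omega] has finite
   area. *)
have Bfin : (\int[lebesgue2]_(x in B) (f (grad u x))%:E)%E \is a fin_num.
  rewrite ge0_fin_numE; last by apply: integral_ge0 => x _; rewrite lee_fin.
  apply: (@le_lt_trans _ _ (0 + C%:E * lebesgue2 (B : set (plane R)))%E).
    have B0 : (B : set (plane R)) `<=` set0 `|` B `|` set0 by left; right.
    have H := ge0_integral_le_split (mu := @lebesgue2 R)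
      (g := fun x => f (grad u x)) mB measurable0 measurable0
      (measure0 (@lebesgue2 R)) B0 (fg0 u) C0 (fun x _ => fC _).
    by apply: (le_trans H); rewrite integral_set0.
  have Boo : (lebesgue2 (B : set (plane R)) < +oo)%E.
    by apply: le_lt_trans Ooo; apply: le_measure; rewrite ?inE.
  by rewrite add0e; apply: (lte_mul_pinfty _ _ Boo).
rewrite Ediff in Ev; have H := le_trans Eu (le_trans (umin.2 _ vadm) Ev).
rewrite -(leeD2lE _ _ Bfin); exact: H.
Qed.
End Truncation.
End EnergyComparison.

(** * The slab at a support line *)

Section BoundaryValues.
Context {R : realType}.

(** [h] is the supremum of the levels that [u] reaches in slabs of every thickness. It may exceed
    [u x0]: [u] can jump at the boundary, and [x0] need not be the only point of [Omega] on the
    line. *)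
Lemma boundary_level (Omega : set (R * R)) (M : R) (u : R * R -> R)
    (a x0 : R * R) (c : R) :
  (forall x, Omega x -> u x <= M) -> Omega x0 -> dotp a x0 = c ->
  exists h, [/\ u x0 <= h, h <= M,
    forall eta T, 0 < eta -> 0 < T ->
      exists x, [/\ Omega x, dotp a x < c + T & h - eta < u x] &
    forall eta, 0 < eta -> exists2 T, 0 < T &
      forall x, Omega x -> dotp a x < c + T -> u x < h + eta].
Proof.
move=> uM Ox0 ax0.
pose H := [set t | forall T, 0 < T ->
  exists x, [/\ Omega x, dotp a x < c + T & t <= u x]].
have H0 : H (u x0) by move=> T T0; exists x0; split => //; rewrite ax0 ltrDl.
have HM : ubound H M.
  by move=> t /(_ 1 ltr01)[x [Ox _ /le_trans]]; apply; exact: uM.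
have supH : has_sup H by split; [exists (u x0)|exists M].
exists (sup H); split.
- exact: ub_le_sup supH.2 _ H0.
- by apply: ge_sup => //; exists (u x0).
- move=> eta T eta0 T0; have [t Ht lt_t] := sup_adherent eta0 supH.
  have [x [Ox dx tu]] := Ht _ T0; exists x; split => //.
  exact: lt_le_trans tu.
- move=> eta eta0; apply: contrapT => nT.
  suff /(ub_le_sup supH.2) : H (sup H + eta) by rewrite gerDl leNgt eta0.
  move=> T T0; apply: contrapT => nx; apply: nT; exists T => // x Ox dx.
  by rewrite ltNge; apply/negP => ux; apply: nx; exists x.
Qed.

(** Moving from [p] to [p - t *: a] stays in [Omega] and lowers [dotp a] by [t * dotp a a], which is
    positive. *)
Lemma dotp_interior_gt (Omega : set (R * R)) (a p : R * R) (c : R) : a != 0 ->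
  (forall x, Omega x -> c <= dotp a x) -> Omega° p -> c < dotp a p.
Proof.
move=> a0 aO /interior_ball_le[r r0 rO].
have na0 : 0 < `|a| by rewrite normr_gt0.
pose t := r / `|a|; have t0 : 0 < t by rewrite divr_gt0.
have : Omega (p + (- t) *: a).
  apply: rO; rewrite addrC addKr normrZ normrN gtr0_norm// /t.
  by rewrite divfK// gt_eqF.
move=> /aO; rewrite dotpD dotpZ => H.
have : 0 < dotp a a.
  have -> : dotp a a = enorm a ^+ 2.
    by rewrite /enorm sqr_sqrtr ?addr_ge0 ?sqr_ge0// /dotp !expr2.
  by rewrite exprn_gt0// enorm_gt0.
move=> /(mulr_gt0 t0); lra.
Qed.

(** The ball of radius [lam * r] around [(1 - lam) *: s + lam *: p] lies in [Omega]. Contracted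
    towards [x1], it becomes a ball of radius [e * (lam * r)] around [x], on which concavity and
    nonnegativity give [u >= (1 - e) * u x1]; then [concave_grad_le] applies. *)
Lemma concave_near_max_grad (Omega : set (R * R)) (u : R * R -> R)
    (x1 s p : R * R) (e lam r m o : R) :
  convex_set Omega -> concave_function Omega u ->
  (forall x, Omega x -> 0 <= u x) ->
  Omega x1 -> Omega s -> 0 < r -> (forall y, `|y - p| <= r -> Omega y) ->
  0 < e < 1 -> 0 < lam <= 1 -> 0 <= o -> m <= (1 - e) * u x1 ->
  let x := (1 - e) *: x1 + e *: ((1 - lam) *: s + lam *: p) in
  u x <= m + o ->
  [/\ Omega° x, m <= u x & enorm (grad u x) <= 2 * (o / (e * (lam * r)))].
Proof.
move=> cO /[dup] cu /concave_functionP cu' u0 Ox1 Os r0 rO e01 l01 o0 mu1 x ux.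
have [/andP[e0 e1] /andP[l0 l1]] := (e01, l01).
have near_x y : `|y - x| <= e * (lam * r) -> Omega y /\ m <= u y.
  move=> yx.
  have Oz z : `|z - ((1 - lam) *: s + lam *: p)| <= lam * r -> Omega z.
    move=> /(convex_set_ball cO rO Os l01)[z' Oz' ->].
    by apply: (convex_setP _).1 => //; rewrite ltW.
  have e01' : 0 < e <= 1 by rewrite e0 ltW.
  have [z Ozz ->] := convex_set_ball cO Oz Ox1 e01' yx.
  have e01'' : 0 <= e <= 1 by rewrite !ltW.
  split; first by apply: (convex_setP _).1.
  apply: le_trans (cu' e x1 z e01'' Ox1 Ozz); apply: (le_trans mu1).
  by rewrite lerDl mulr_ge0 ?u0// ltW.
have rho0 : 0 < e * (lam * r) by rewrite !mulr_gt0.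
split.
- by apply: (ball_le_interior rho0) => y /near_x[].
- have [] := near_x x => //; by rewrite subrr normr0 ltW.
- exact: (concave_grad_le cu rho0 o0 near_x ux).
Qed.

Lemma lebesgue2_bigsetU_ge (F : nat -> set (R * R)) (k : R) n :
  (forall i, measurable (F i : set (plane R))) -> trivIset setT F ->
  (forall i, (i < n)%N -> (k%:E <= lebesgue2 (F i : set (plane R)))%E) ->
  ((n%:R * k)%:E <= lebesgue2 (\big[setU/set0]_(i < n) F i : set (plane R)))%E.
Proof.
move=> mF tF kF.
have -> : lebesgue2 (\big[setU/set0]_(i < n) F i : set (plane R)) =
    (\sum_(i < n) lebesgue2 (F i : set (plane R)))%E.
  exact: (measure_bigsetU (@lebesgue2 R) mF tF).
apply: le_trans (_ : (\sum_(i < n) k%:E <= _)%E).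
  by rewrite sumEFin sumr_const card_ord mulr_natl.
by apply: lee_sum => i _; exact: kF.
Qed.

End BoundaryValues.

(** * Estimates on the small copies of a slab *)

Section Copies.
Context {R : realType}.

(** Gives the number [n] of copies, about [C / delta]. *)
Lemma exists_nat_scale (C delta : R) : 0 < C -> 0 < delta -> delta <= 1 ->
  exists2 n : nat, 1 <= n%:R :> R &
    C <= n%:R * delta /\ n%:R * delta <= C + 1.
Proof.
move=> C0 d0 d1; exists (Num.truncn (C / delta)).+1; first by rewrite ler1n.
have /andP[n1 n2] := truncn_itv (ltW (divr_gt0 C0 d0)).
split; first by rewrite -ler_pdivrMr// ltW.
by rewrite -natr1 mulrDl mul1r lerD// -ler_pdivlMr.
Qed.

(** Bounds the depth of a copy, that is, its linear distance to the support line: [d1], [q] and [lP]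
    come from [x1], from the slab point and from [p]. *)
Lemma copy_depth_lt (e n T d1 q lP : R) : 0 < e -> 1 <= n -> 0 < T ->
  0 <= d1 < e * T -> q < T -> lP + T <= 2 * n * T ->
  (1 - e) * d1 + e * (q + lP) < 3 * (n * e) * T.
Proof.
move=> e0 n1 T0 /andP[d10 d1e] qT lPT.
have H1 : 0 <= e * d1 by rewrite mulr_ge0// ltW.
have H2 : e * (q + lP) < e * (2 * n * T) by rewrite ltr_pM2l//; lra.
have H3 : 1 * (e * T) <= n * (e * T) by rewrite ler_pM2r// mulr_gt0.
lra.
Qed.

(** On a copy [u] is at most the left side, while near it [u] is at least
    [(1 - e) * (h - e * h)]. *)
Lemma copy_oscillation (e h : R) : 0 < e -> 0 < h ->
  h + e * h <= (1 - e) * (h - e * h) + 3 * (e * h).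
Proof.
move=> e0 h0; have : 0 <= e * (e * h) by rewrite !mulr_ge0 ?(ltW e0) ?(ltW h0).
lra.
Qed.

(** The left side is [M / T] times the maximal depth [3 * (n * e) * T] when [n * e * M = h / 12]:
    the cutting plane stays below [u] on the copies. *)
Lemma copy_value_gt (e h : R) : 0 < e -> e <= 1 / 12 -> 0 < h ->
  3 * (h / 12) < (1 - e) * (h - e * h).
Proof.
move=> e0 e12 h0.
have : 0 <= e * (e * h) by rewrite !mulr_ge0 ?(ltW e0) ?(ltW h0).
have : e * h <= 1 / 12 * h by rewrite ler_pM2r.
lra.
Qed.

(** Since [g <= 6 * h / (lam * r)] and [lam >= n * T / P], [g * T] is at most half of
    [M * delta * al]; [T] is at most a quarter of it, which leaves room for the summand 1. *)
Lemma copy_slope_lt (g e h lam r P n T M delta al : R) :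
  0 < e -> 0 < lam -> 0 < r -> 0 < P -> 0 < T -> 0 < M -> 0 < delta -> 0 < al ->
  g <= 2 * (3 * (e * h) / (e * (lam * r))) ->
  n * T <= lam * P -> 12 * h * P <= n * delta * (M * r * al) ->
  T * 4 <= M * delta * al ->
  1 + g < delta * (M / T * al).
Proof.
move=> e0 l0 r0 P0 T0 M0 d0 al0 gle nT nd TM.
have Mda : 0 < M * delta * al by rewrite !mulr_gt0.
have -> : delta * (M / T * al) = M * delta * al / T.
  by clear -T0; field; rewrite gt_eqF.
rewrite ltr_pdivlMr//.
suff : g * T <= M * delta * al / 2.
  by clear -TM Mda; lra.
have {}gle : g * (lam * r) <= 6 * h.
  rewrite -ler_pdivlMr ?mulr_gt0//; apply: (le_trans gle).
  rewrite le_eqVlt; apply/orP; left; apply/eqP.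
  by clear -e0 l0 r0; field; rewrite !gt_eqF.
have lrP : 0 < lam * r * P by rewrite !mulr_gt0.
rewrite -(ler_pM2r lrP).
have H1 : g * (lam * r) * (T * P) <= 6 * h * (T * P).
  by rewrite ler_pM2r ?mulr_gt0.
have H2 : 12 * h * P * T <= n * delta * (M * r * al) * T by rewrite ler_pM2r.
have H3 : (delta * (M * r * al)) * (n * T) <= (delta * (M * r * al)) * (lam * P).
  by rewrite ler_pM2l// !mulr_gt0.
clear -H1 H2 H3; lra.
Qed.

(* The homothetic copies of a thin slab are placed where the gradient of [u] is
   small compared with the slope [M / T * enorm a] of the truncating plane: there
   the oscillation of [u] is at most [3 * (e * h)] on a ball of radius
   [e * (lam * r)]. *)
Lemma slab_copy (Omega : set (R * R)) (u : R * R -> R) (a p x1 s : R * R)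
    (c r h M e n lam T T1 delta : R) :
  convex_set Omega -> concave_function Omega u ->
  (forall x, Omega x -> 0 <= u x) -> (forall x, Omega x -> c <= dotp a x) ->
  (forall x, Omega x -> dotp a x < c + T1 -> u x < h + e * h) ->
  (forall y, `|y - p| <= r -> Omega y) ->
  Omega x1 -> dotp a x1 < c + e * T -> h - e * h < u x1 ->
  Omega s -> dotp a s < c + T ->
  a != 0 -> 0 < dotp a p - c -> 0 < r -> 0 < h -> h <= M -> 0 < delta ->
  1 <= n -> 0 < e -> n * e * M = h / 12 ->
  0 < T -> T <= T1 -> T * 4 <= M * delta * enorm a ->
  12 * h * (dotp a p - c) <= n * delta * (M * r * enorm a) ->
  0 < lam -> lam <= 1 / 2 -> n * T <= lam * (dotp a p - c) ->
  lam * (dotp a p - c) + T <= 2 * n * T ->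
  let x := (1 - e) *: x1 + e *: ((1 - lam) *: s + lam *: p) in
  [/\ Omega° x, M / T * (dotp a x - c) < u x,
    (1 - e) * (dotp a x1 - c) + e * (lam * (dotp a p - c)) <= dotp a x - c,
    dotp a x - c <
      (1 - e) * (dotp a x1 - c) + e * (lam * (dotp a p - c) + T) &
    1 + enorm (grad u x) < delta * (M / T * enorm a)].
Proof.
move=> cO cu u0 aO hT1 rO Ox1 dx1 ux1 Os ds an0 P0 r0 h0 hM d0 n1 e0 neM.
move=> T0 TT1 TM nd l0 l12 nT lPT x.
have M0 : 0 < M by exact: lt_le_trans hM.
have al0 := enorm_gt0 an0.
(* By [copy_depth_lt] the copies then have depth below [T / 4], so they stay in the slab where
   [u < h + e * h]. *)
have ne12 : n * e <= 1 / 12 by rewrite -(ler_pM2r M0) neM; clear -hM; lra.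
have e12 : e <= 1 / 12.
  by apply: le_trans ne12; rewrite -{1}(mul1r e) ler_pM2r.
have e01 : 0 < e < 1 by rewrite e0; clear -e12; lra.
have l01 : 0 < lam <= 1 by rewrite l0; clear -l12; lra.
set P := dotp a p - c in P0 nd nT lPT *.
have dxE : dotp a x - c = (1 - e) * (dotp a x1 - c) +
    e * ((1 - lam) * (dotp a s - c) + lam * P).
  by rewrite /x !(dotpD, dotpZ) /P; clear; ring.
have ds0 : 0 <= dotp a s - c by rewrite subr_ge0 aO.
have dx10 : 0 <= dotp a x1 - c < e * T.
  by rewrite subr_ge0 aO//= ltrBlDl.
have q0 : 0 <= (1 - lam) * (dotp a s - c).
  by rewrite mulr_ge0// subr_ge0; case/andP: l01.
have qT : (1 - lam) * (dotp a s - c) < T.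
  have : 0 <= lam * (dotp a s - c) by rewrite mulr_ge0// ltW.
  by move: ds; clear; lra.
have lo : (1 - e) * (dotp a x1 - c) + e * (lam * P) <= dotp a x - c.
  by rewrite dxE lerD2l ler_pM2l// lerDr.
have hi : dotp a x - c < (1 - e) * (dotp a x1 - c) + e * (lam * P + T).
  by rewrite dxE ltrD2l ltr_pM2l// addrC ltrD2l.
have hi2 : dotp a x - c < 3 * (n * e) * T by rewrite dxE; exact: copy_depth_lt.
have dxT1 : dotp a x < c + T1.
  have : n * e * T <= 1 / 12 * T by rewrite ler_pM2r.
  by move: hi2 TT1 T0; clear; lra.
have o0 : 0 <= 3 * (e * h) by rewrite !mulr_ge0 ?(ltW e0) ?(ltW h0).
have mu1 : (1 - e) * (h - e * h) <= (1 - e) * u x1.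
  by rewrite ler_pM2l ?(ltW ux1)// subr_gt0; case/andP: e01.
have Ox : Omega x.
  apply: (convex_setP _).1 => //.
    by case/andP: e01 => *; rewrite !ltW.
  apply: (convex_setP _).1 => //.
    by case/andP: l01 => *; rewrite ltW.
  by apply: rO; rewrite subrr normr0 ltW.
have ux : u x <= (1 - e) * (h - e * h) + 3 * (e * h).
  by apply: le_trans (copy_oscillation e0 h0); exact/ltW/hT1.
have [Ix mux gx] :=
  concave_near_max_grad cO cu u0 Ox1 Os r0 rO e01 l01 o0 mu1 ux.
split => //.
  apply: lt_le_trans mux; apply: lt_le_trans (ltW (copy_value_gt e0 e12 h0)).
  have -> : 3 * (h / 12) = M / T * (3 * (n * e) * T).
    by rewrite -neM; clear -T0; field; rewrite gt_eqF.
  by rewrite ltr_pM2l// divr_gt0.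
exact: (copy_slope_lt e0 l0 r0 P0 T0 M0 d0 al0 gx nT nd TM).
Qed.
End Copies.

(** * Choice of the constants and the contradiction *)

Section Core.
Context {R : realType}.

(** As [n * e / 2 = h / (24 * M)], the right side equals [2 * (C + 1) / (n * delta)], which is at
    least 2. *)
Lemma copies_gain (C h M e n delta : R) :
  0 < h -> 0 < delta -> 0 < C -> n * e * M = h / 12 ->
  0 < n -> n * delta <= C + 1 ->
  1 < 2 * (24 * M / h) ^+ 2 * (C + 1) / delta * (n * (e / 2) ^+ 2).
Proof.
move=> h0 d0 C0 neM n0 nup.
have E : 24 * M / h * (n * e / 2) = 1.
  have -> : 24 * M / h * (n * e / 2) = 12 / h * (n * e * M).
    by clear -h0; field; rewrite gt_eqF.
  by rewrite neM; clear -h0; field; rewrite gt_eqF.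
have -> : 2 * (24 * M / h) ^+ 2 * (C + 1) / delta * (n * (e / 2) ^+ 2) =
    2 * (24 * M / h * (n * e / 2)) ^+ 2 * (C + 1) / (n * delta).
  by clear -h0 d0 n0; field; rewrite !gt_eqF.
rewrite E expr1n mulr1 ltr_pdivlMr ?mulr_gt0// mul1r.
by move: nup C0; clear; lra.
Qed.

Lemma slab_gt0 (Omega : set (R * R)) (a p x0 : R * R) (T : R) :
  convex_set Omega -> Omega° p -> Omega x0 -> 0 < dotp a p - dotp a x0 ->
  0 < T ->
  (0 < lebesgue2 (Omega° `&` [set x | dotp a x < dotp a x0 + T]%R : set (plane R)))%E.
Proof.
move=> cO Op Ox0 P0 T0; apply: lebesgue2_open_gt0.
  apply: openI; first exact: open_interior.
  apply: (open_comp (D := [set y | y < dotp a x0 + T])); last exact: open_lt.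
  by move=> x _; exact: dotp_continuous.
set P := dotp a p - dotp a x0 in P0.
pose t := Num.min 1 (T / (2 * P)).
have t0 : 0 < t by rewrite lt_min ltr01 divr_gt0 ?mulr_gt0.
have t1 : t <= 1 by rewrite ge_min lexx.
have tP : t * P <= T / 2.
  have : t <= T / (2 * P) by rewrite ge_min lexx orbT.
  rewrite ler_pdivlMr ?mulr_gt0//; clear; lra.
exists ((1 - t) *: x0 + t *: p); split.
  by apply: convex_interior => //; rewrite t0.
rewrite /= dotpD !dotpZ.
have -> : (1 - t) * dotp a x0 + t * dotp a p = dotp a x0 + t * P.
  by rewrite /P; clear; ring.
by rewrite ltrD2l; move: tP T0; clear; lra.
Qed.

(** The constants are chosen in the order [h], [C], [N], [delta], [n], [e], [T1], [T], [x1]. To be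
    chosen before [delta], [N] must not depend on [n]; hence the two-sided control of [n * delta] by
    [C]. *)
Lemma minimizer_le0_support (Omega : set (R * R)) (M : R) (f u : R * R -> R)
    (a x0 : R * R) :
  compact Omega -> convex_set Omega -> Omega° !=set0 -> 0 < M ->
  (forall x, 0 < f x) -> continuous f -> growth_condition f ->
  minimizer Omega M f u -> a != 0 -> Omega x0 ->
  (forall x, Omega x -> dotp a x0 <= dotp a x) -> u x0 <= 0.
Proof.
move=> kO cO [p Op] M0 f0 cf gf umin an0 Ox0 aO.
rewrite leNgt; apply/negP => ux0.
have [cu uM] := umin.1.
have u_ge0 x : Omega x -> 0 <= u x by move=> /uM/andP[].
have u_leM x : Omega x -> u x <= M by move=> /uM/andP[].
have [h [u0h hM hnear hle]] :=
  boundary_level u_leM Ox0 (erefl (dotp a x0)).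
have h0 : 0 < h by exact: (lt_le_trans ux0 u0h).
have [r r0 rO] := interior_ball_le Op.
have := dotp_interior_gt an0 aO Op; rewrite -subr_gt0.
set P := dotp a p - dotp a x0 => P0.
have al0 : 0 < enorm a by exact: enorm_gt0.
have Mra0 : 0 < M * r * enorm a by rewrite !mulr_gt0.
(* This [C] turns [C <= n * delta] into the lower bound on [n * delta] required by
   [copy_slope_lt]. *)
have [C C0 CE] : exists2 C, 0 < C & 12 * h * P = C * (M * r * enorm a).
  exists (12 * h * P / (M * r * enorm a)); first by rewrite divr_gt0// !mulr_gt0.
  by rewrite divfK// gt_eqF.
have [N N0 NE] : exists2 N, 0 < N & N = 2 * (24 * M / h) ^+ 2 * (C + 1).
  eexists; last reflexivity.
  have Mh0 : 0 < 24 * M / h by rewrite divr_gt0// mulr_gt0.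
  by rewrite mulr_gt0 ?addr_gt0// mulr_gt0// exprn_gt0.
(* Dividing by [(1 + enorm x) / enorm y], which is below [delta], improves the factor [N] to
   [N / delta]. *)
have [delta [d0 d1 growth]] : exists delta, [/\ 0 < delta, delta <= 1 &
    forall x y, y != 0 -> 1 + enorm x < delta * enorm y ->
      N / delta * f y <= f x].
  have [delta0 delta00 growth] := gf _ N0.
  exists (Num.min 1 delta0); split; [by rewrite lt_min ltr01|by rewrite ge_min lexx|].
  set delta := Num.min 1 delta0 => x y y0 xy.
  have d0 : 0 < delta by rewrite lt_min ltr01.
  have ey := enorm_gt0 y0.
  have xy' : (1 + enorm x) / enorm y < delta0.
    by rewrite ltr_pdivrMr// (lt_le_trans xy)// ler_pM2r// ge_min lexx orbT.
  have := growth x y y0 xy'; rewrite ltr_pdivlMr ?mulr_gt0// => H.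
  rewrite mulrAC ler_pdivrMr// -(ler_pM2l ey) mulrCA; apply: (le_trans (ltW H)).
  rewrite mulrCA (mulrC (f x)) ler_pM2r// (mulrC (enorm y)).
  exact: ltW.
have [n n1 [nlow nup]] := exists_nat_scale C0 d0 d1.
have nR0 : 0 < n%:R :> R by exact: lt_le_trans n1.
have nd : 12 * h * P <= n%:R * delta * (M * r * enorm a).
  by rewrite CE ler_pM2r.
have [e e0 neM] : exists2 e, 0 < e & n%:R * e * M = h / 12.
  exists (h / (12 * n%:R * M)); first by rewrite divr_gt0// !mulr_gt0.
  by clear -nR0 M0; field; rewrite !gt_eqF.
have eh0 : 0 < e * h by exact: mulr_gt0.
have [T1 T10 hT1] := hle (e * h) eh0.
(* The bounds on [T] place the slab where [u < h + e * h], make each [lam k] with [k < n] at most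
   [1 / 2], and leave room for the 1 in [copy_slope_lt]. *)
have [T [T0 TT1 TP TM]] : exists T, [/\ 0 < T, T <= T1, T * (4 * n%:R) <= P &
    T * 4 <= M * delta * enorm a].
  exists (Num.min (Num.min T1 (P / (4 * n%:R))) (M * delta * enorm a / 4)).
  split; first by rewrite !lt_min T10 ?divr_gt0 ?mulr_gt0.
  - by rewrite !ge_min lexx.
  - by rewrite -ler_pdivlMr ?mulr_gt0// !ge_min lexx orbT.
  - by rewrite -ler_pdivlMr// !ge_min lexx orbT.
have [x1 [Ox1 dx1 ux1]] := hnear (e * h) (e * T) eh0 (mulr_gt0 e0 T0).
pose S : set (R * R) := [set x | Omega x /\ dotp a x < dotp a x0 + T].
have oS : open [set x : R * R | dotp a x < dotp a x0 + T].
  apply: (open_comp (D := [set y | y < dotp a x0 + T])); last exact: open_lt.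
  by move=> x _; exact: dotp_continuous.
have mO : measurable (Omega : set (plane R)).
  by apply: closed_measurable_plane; exact: compact_closed.
have mS : measurable (S : set (plane R)).
  exact: (measurableI _ _ mO (open_measurable_plane oS)).
(* Starting at [n] gives the lower bound on [lam k] behind the gradient estimate; steps of [T / P]
   make the copies disjoint. *)
have [lam lamE] : exists lam : nat -> R, forall k, lam k * P = (n%:R + k%:R) * T.
  exists (fun k => (n%:R + k%:R) * T / P) => k.
  by rewrite divfK// gt_eqF.
have lamSE k : lam k.+1 * P = lam k * P + T.
  by rewrite !lamE -natr1; clear; ring.
have lam_ge k : n%:R * T <= lam k * P.
  by rewrite lamE ler_pM2r// lerDl.
have lam_le k : (k < n)%N -> lam k * P + T <= 2 * n%:R * T.
  move=> kn; have : k.+1%:R <= n%:R :> R by rewrite ler_nat.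
  by rewrite -lamSE lamE ler_pM2r// mulr_natl mulr2n lerD2l.
have lam0 k : 0 < lam k.
  by rewrite -(pmulr_lgt0 _ P0) (lt_le_trans _ (lam_ge k))// mulr_gt0.
have lam12 k : (k < n)%N -> lam k <= 1 / 2.
  move=> /lam_le H; rewrite -(ler_pM2r P0); move: H TP T0; clear; lra.
have lam2 k : (k < n)%N -> 1 / 2 <= 1 - lam k.
  by move=> /lam12; clear; lra.
have elam0 k : (k < n)%N -> 0 < e * (1 - lam k).
  by move=> /lam2 H; rewrite mulr_gt0// (lt_le_trans _ H)// divr_gt0.
(* Each copy is written as one homothety of ratio [e * (1 - lam k)]; the empty sets from [n] on
   complete a disjoint sequence. *)
pose D (k : nat) : set (R * R) :=
  if (k < n)%N then
    (fun x => ((1 - e) *: x1 + (e * lam k) *: p) + (e * (1 - lam k)) *: x) @` S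
  else set0.
pose K := M / T; have K0 : 0 < K by rewrite divr_gt0.
pose b := K *: a.
pose A : set (R * R) :=
  [set x | Omega° x /\ dotp b x + (- (K * dotp a x0)) < u x].
have DA k x : D k x ->
    [/\ A x, (1 - e) * (dotp a x1 - dotp a x0) + e * (lam k * P) <= dotp a x - dotp a x0,
     dotp a x - dotp a x0 <
       (1 - e) * (dotp a x1 - dotp a x0) + e * (lam k * P + T) &
     1 + enorm (grad u x) < delta * enorm b].
  rewrite /D; case: ifPn => // kn [s [Os ds] <-].
  have -> : (1 - e) *: x1 + (e * lam k) *: p + (e * (1 - lam k)) *: s =
      (1 - e) *: x1 + e *: ((1 - lam k) *: s + lam k *: p).
    by rewrite scalerDr !scalerA -addrA (addrC (_ *: p)).
  rewrite /b (enormZ _ (ltW K0)).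
  have [Ix lux lo hi gx] := slab_copy cO cu u_ge0 aO hT1 rO Ox1 dx1 ux1 Os ds an0
    P0 r0 h0 hM d0 n1 e0 neM T0 TT1 TM nd (lam0 k) (lam12 k kn) (lam_ge k)
    (lam_le k kn).
  by split => //; split => //; rewrite /b dotpZl -mulrBr.
have l0 x : Omega x -> 0 <= dotp b x + (- (K * dotp a x0)).
  by move=> /aO H; rewrite /b dotpZl -mulrBr mulr_ge0 ?(ltW K0)// subr_ge0.
(* Where the plane lies below [u <= M = K * T], the depth is below [T]. *)
have AS : A `<=` S.
  move=> x [/interior_subset Ox lux]; split => //.
  have : K * (dotp a x - dotp a x0) < K * T.
    apply: lt_le_trans (_ : _ < M) _; last by rewrite /K divfK// gt_eqF.
    by apply: lt_le_trans (u_leM x Ox); move: lux; rewrite /b dotpZl -mulrBr.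
  by rewrite ltr_pM2l// ltrBlDl.
have mA : measurable (A : set (plane R)).
  exact: (measurable_above b (- (K * dotp a x0)) umin).
have sA : (lebesgue2 (A : set (plane R)) <= lebesgue2 (S : set (plane R)))%E.
  by apply: le_measure; rewrite ?inE.
have Soo : (lebesgue2 (S : set (plane R)) < +oo)%E.
  apply: le_lt_trans (compact_lebesgue2_fin kO); apply: le_measure; rewrite ?inE//.
  by move=> x [].
have S0 : (0 < lebesgue2 (S : set (plane R)))%E.
  apply: lt_le_trans (slab_gt0 cO Op Ox0 P0 T0) _.
  apply: le_measure; rewrite ?inE//.
    by apply: open_measurable_plane; apply: openI => //; exact: open_interior.
  by move=> x [/interior_subset].
have mD k : measurable (D k : set (plane R)).
  rewrite /D; case: ifPn => // kn; apply: measurable_homothety_image => //.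
  by rewrite gt_eqF// elam0.
pose D' := \big[setU/set0]_(k < n) D k.
have mD' : measurable (D' : set (plane R)).
  by apply: bigsetU_measurable => k _; exact: mD.
have D'D x : D' x -> exists k, D k x.
  by rewrite /D' -bigcup_mkord => -[k _ Dkx]; exists k.
have kk0 : 0 <= N / delta * f b.
  by rewrite mulr_ge0 ?(ltW (f0 _))// ltW// divr_gt0.
have D'A : D' `<=` A by move=> x /D'D[k /DA[]].
have bn0 : b != 0 by rewrite scaler_eq0 negb_or an0 andbT gt_eqF.
have D'f x : D' x -> N / delta * f b <= f (grad u x).
  by move=> /D'D[k /DA[_ _ _]]; exact: growth.
have Hmin := minimizer_truncation kO cO f0 cf gf umin l0 mD' D'A kk0 D'f.
have [s sE] : exists s, lebesgue2 (S : set (plane R)) = s%:E.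
  exists (fine (lebesgue2 (S : set (plane R)))).
  by rewrite fineK// ge0_fin_numE// ltW.
have s0 : 0 < s by rewrite -lte_fin -sE.
have D'ge : ((n%:R * ((e / 2) ^+ 2 * s))%:E <= lebesgue2 (D' : set (plane R)))%E.
  apply: lebesgue2_bigsetU_ge => //.
    (* For [l < k], every point of copy [l] is strictly less deep than every point of copy [k]. *)
    apply: ltn_trivIset => k l lk; apply/eqP; apply: contraT => /set0P[x [Dl Dk]].
    have [_ _ up _] := DA l x Dl; have [_ lo _ _] := DA k x Dk.
    have H : lam l * P + T <= lam k * P.
      by rewrite -lamSE !lamE ler_pM2r// lerD2l ler_nat.
    have := le_lt_trans lo up; rewrite ltrD2l ltr_pM2l// => /lt_le_trans/(_ H).
    by rewrite ltxx.
  (* The ratio is at least [e / 2] because [lam k <= 1 / 2]. *)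
  move=> k kn; rewrite /D kn (lebesgue2_homothety _ (elam0 k kn) mS) sE.
  rewrite -EFinM lee_fin ler_pM2r// ler_sqr ?nnegrE; last 2 first.
  - by rewrite divr_ge0// ltW.
  - by rewrite ltW// elam0.
  by rewrite ler_pM2l// -div1r lam2.
(* Both areas are replaced by multiples of the slab area [s], so that [f b * s] cancels against
   [copies_gain]. *)
have H : N / delta * f b * (n%:R * ((e / 2) ^+ 2 * s)) <= f b * s.
  rewrite -lee_fin [leLHS]EFinM [leRHS]EFinM -sE.
  apply: le_trans (le_trans Hmin _).
    by apply: lee_wpmul2l => //; rewrite lee_fin.
  by apply: lee_wpmul2l => //; rewrite lee_fin ltW.
have fs0 : 0 < f b * s by exact: mulr_gt0.
have := copies_gain h0 d0 C0 neM nR0 nup.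
rewrite -NE -(ltr_pM2r fs0) mul1r ltNge => /negP; apply.
apply: le_trans H; rewrite le_eqVlt; apply/orP; left; apply/eqP.
by clear; ring.
Qed.
End Core.

Unset Implicit Arguments.

Theorem theorem2 (R : realType) (Omega : set (R * R)) (M : R)
    (f u : R * R -> R)
    (Omega_compact : compact Omega)
    (Omega_convex : convex_set Omega)
    (Omega_int : Omega° !=set0)
    (M_gt0 : 0 < M)
    (f_gt0 : forall x, 0 < f x)
    (f_cont : continuous f)
    (f_growth : growth_condition f)
    (Omega_regular : forall x, boundary Omega x -> regular_point Omega x)
    (u_min : minimizer Omega M f u) :
  forall x, boundary Omega x -> u x = 0.
Proof.
move=> x bx; have [_ [L [[a [c [a0 LE Lx sides]]] _]]] := Omega_regular x bx.
have Ox : Omega x.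
  have cO : closed Omega by exact: compact_closed.
  by rewrite (closure_id Omega).1//; case: bx.
have [_ uM] := u_min.1; have /andP[u0 _] := uM x Ox.
apply/eqP; rewrite eq_le u0 andbT.
have {Lx} ax : dotp a x = c by move: Lx; rewrite LE.
have support (b : R * R) : b != 0 ->
    (forall y, Omega y -> dotp b x <= dotp b y) -> u x <= 0.
  by move=> b0 bO; exact: (minimizer_le0_support Omega_compact Omega_convex
    Omega_int M_gt0 f_gt0 f_cont f_growth u_min b0 Ox bO).
(* The normal must point into the half-plane containing [Omega]; otherwise it is reversed. *)
have [aO|aO] := sides; last by apply: (support a) => // y /aO; rewrite ax.
apply: (support (- a)); first by rewrite oppr_eq0.
by move=> y /aO/= ay; rewrite -scaleN1r !dotpZl !mulN1r lerN2 ax.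
Qed.
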